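(* Let $I\subseteq\mathbb{R}$ be an open interval and let $B,C,R:I\to\mathbb{C}$ be functions, with $B$ differentiable, such that for some constant $k\neq 0$ and all $x\in I$ $$\frac{B(x)^2+2B'(x)-4C(x)}{4}=k.$$ Let $\sqrt{k}$ be a square root of $k$ in $\mathbb{C}$, let $c$ be any constant such that $s(x):=e^{\sqrt{k}(x+c)}-e^{-\sqrt{k}(x+c)}\neq 0$ for all $x\in I$, and assume that the indefinite integral $\int e^{\int\frac{B(x)}{2}\,dx}s(x)R(x)\,dx$ exists on $I$. Then the general solution on $I$ of $$y''+B(x)y'+C(x)y=R(x)$$ is $$y=e^{-\int\frac{B(x)}{2}\,dx}\,s(x)\int\frac{1}{s(x)^2}\left(\int e^{\int\frac{B(x)}{2}\,dx}\,s(x)R(x)\,dx\right)dx+C_1e^{-\left(\int\frac{B(x)}{2}\,dx+\sqrt{k}(x+c)\right)}+C_2e^{-\int\frac{B(x)}{2}\,dx+\sqrt{k}(x+c)},$$ where $C_1,C_2\in\mathbb{C}$ are arbitrary constants; that is, a twice differentiable function $y:I\to\mathbb{C}$ satisfies the differential equation on $I$ if and only if it has this form for some $C_1,C_2\in\mathbb{C}$.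
   Context: An indefinite integral $\int u(x)\,dx$ of a function $u$ on $I$ denotes one fixed (arbitrarily chosen) antiderivative of $u$ on $I$, i.e. a differentiable function $U$ with $U'=u$ on $I$; each time the same integral occurs the same antiderivative is used. The arbitrary constants of integration are displayed explicitly as $C_1,C_2$. Constants are complex numbers. *)

(* Defs.v *)
From Stdlib Require Import Reals.
From Coquelicot Require Import Coquelicot.
Open Scope C_scope.

Definition Cexp (z : C) : C :=
  ((exp (Re z) * cos (Im z))%R, (exp (Re z) * sin (Im z))%R).

(* Endpoints may be infinite. Functions on the interval are total functions on
   R whose values off the interval are irrelevant: the interval is open, so a
   derivative at one of its points depends only on the values inside it. *)
Definition in_oo (lo hi : Rbar) (x : R) : Prop := Rbar_lt lo x /\ Rbar_lt x hi.

(* The derivative is with respect to a real variable, hence C is taken with its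
   structure of real normed space. *)
Definition is_derive_RC (f : R -> C) (x : R) (l : C) : Prop :=
  @is_derive R_AbsRing C_R_NormedModule f x l.

Definition is_antiderivative (lo hi : Rbar) (u U : R -> C) : Prop :=
  forall x : R, in_oo lo hi x -> is_derive_RC U x (u x).

Definition solves_ode2 (lo hi : Rbar) (p q r y : R -> C) : Prop :=
  exists y' y'' : R -> C,
    forall x : R, in_oo lo hi x ->
      is_derive_RC y x (y' x) /\
      is_derive_RC y' x (y'' x) /\
      y'' x + p x * y' x + q x * y x = r x.

Definition s_fun (w c : C) (x : R) : C :=
  Cexp (w * (RtoC x + c)) - Cexp (- (w * (RtoC x + c))).

(* Main.v *)
Require Import Defs.
From Stdlib Require Import Reals Lra Classical.
From Coquelicot Require Import Coquelicot.
Open Scope C_scope.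

(** The substitution [z = e^A y] with [A' = B/2] removes the first-order term and
    leaves [z'' - k z = e^A R].  As [s'' = k s], the Wronskian-like expression
    [z' s - z s'] has derivative [e^A s R], so it equals [P + K] and
    [(z/s)' = (P + K)/s^2].  Both terms integrate, the second one because
    [(e^(-sqrt k (x+c))/s)' = - 2 sqrt k / s^2]. *)

(** * Functional equation of the complex exponential *)

Lemma Cexp_add (u v : C) : Cexp (u + v) = Cexp u * Cexp v.
Proof.
  destruct u as [a b]; destruct v as [a' b'].
  unfold Cexp, Cmult, Cplus; simpl.
  rewrite exp_plus, cos_plus, sin_plus; f_equal; ring.
Qed.

Lemma Cexp_mul_opp (u : C) : Cexp u * Cexp (- u) = RtoC 1.
Proof.
  rewrite <- Cexp_add.
  replace (u + - u) with (RtoC 0) by ring.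
  unfold Cexp, RtoC; simpl.
  rewrite exp_0, cos_0, sin_0; f_equal; ring.
Qed.

(** * Differential calculus of complex-valued functions of a real variable *)

Lemma is_derive_RC_ext (f g : R -> C) (x : R) (l m : C) :
  (forall t, f t = g t) -> l = m -> is_derive_RC f x l -> is_derive_RC g x m.
Proof. intros E <-; apply is_derive_ext, E. Qed.

(** The projections are linear, and conversely f = (Re f) 1 + (Im f) i. This reduces the product,
    inverse and exponential rules to real derivatives, where [auto_derive] applies. *)
Lemma is_derive_RC_pair (f : R -> C) (x : R) (l : C) :
  is_derive_RC f x l <->
  is_derive (fun t => Re (f t)) x (Re l) /\ is_derive (fun t => Im (f t)) x (Im l).
Proof.
  split.
  - intros H; split.
    + apply (filterdiff_comp' (U := R_NormedModule) (V := C_R_NormedModule)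
        f (fst : C -> R) x _ (fst : C -> R) H).
      apply filterdiff_linear, is_linear_fst.
    + apply (filterdiff_comp' (U := R_NormedModule) (V := C_R_NormedModule)
        f (snd : C -> R) x _ (snd : C -> R) H).
      apply filterdiff_linear, is_linear_snd.
  - intros [Hr Hi].
    generalize (is_derive_plus (V := C_R_NormedModule) _ _ x _ _
      (is_derive_scal_l (V := C_R_NormedModule) _ x _ (RtoC 1) Hr)
      (is_derive_scal_l (V := C_R_NormedModule) _ x _ Ci Hi)).
    apply is_derive_RC_ext; [intros t; destruct (f t) as [a b] | destruct l as [a b]];
      unfold plus, scal; simpl; unfold prod_plus, prod_scal, plus, scal, mult; simpl;
      unfold mult; simpl; f_equal; ring.
Qed.

Lemma is_derive_RC_const (a : C) (x : R) : is_derive_RC (fun _ => a) x (RtoC 0).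
Proof. apply (is_derive_const (V := C_R_NormedModule)). Qed.

Lemma is_derive_RC_id (x : R) : is_derive_RC RtoC x (RtoC 1).
Proof.
  apply is_derive_RC_pair; simpl; split;
    [apply (is_derive_id (K := R_AbsRing))
    | apply (is_derive_const (K := R_AbsRing) (V := R_NormedModule))].
Qed.

Lemma is_derive_RC_plus (f g : R -> C) (x : R) (l m : C) :
  is_derive_RC f x l -> is_derive_RC g x m ->
  is_derive_RC (fun t => f t + g t) x (l + m).
Proof. apply (is_derive_plus (V := C_R_NormedModule)). Qed.

Lemma is_derive_RC_opp (f : R -> C) (x : R) (l : C) :
  is_derive_RC f x l -> is_derive_RC (fun t => - f t) x (- l).
Proof. apply (is_derive_opp (V := C_R_NormedModule)). Qed.

Lemma is_derive_RC_minus (f g : R -> C) (x : R) (l m : C) :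
  is_derive_RC f x l -> is_derive_RC g x m ->
  is_derive_RC (fun t => f t - g t) x (l - m).
Proof. apply (is_derive_minus (V := C_R_NormedModule)). Qed.

Lemma is_derive_RC_mult (f g : R -> C) (x : R) (l m : C) :
  is_derive_RC f x l -> is_derive_RC g x m ->
  is_derive_RC (fun t => f t * g t) x (l * g x + f x * m).
Proof.
  rewrite !is_derive_RC_pair; simpl; intros [H1 H2] [H3 H4].
  (* With the components named as real functions, [auto_derive] treats them as atoms and leaves
     their [Derive], which [is_derive_unique] evaluates. *)
  set (fr := fun t => Re (f t)) in *; set (fi := fun t => Im (f t)) in *.
  set (gr := fun t => Re (g t)) in *; set (gi := fun t => Im (g t)) in *.
  split.
  - change (is_derive (fun t => fr t * gr t - fi t * gi t)%R x
      ((Re l * gr x - Im l * gi x) + (fr x * Re m - fi x * Im m))%R).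
    auto_derive; [repeat split; eexists; eassumption|].
    rewrite (is_derive_unique (fun t : R => fr t) x _ H1),
      (is_derive_unique (fun t : R => fi t) x _ H2),
      (is_derive_unique (fun t : R => gr t) x _ H3),
      (is_derive_unique (fun t : R => gi t) x _ H4); ring.
  - change (is_derive (fun t => fr t * gi t + fi t * gr t)%R x
      ((Re l * gi x + Im l * gr x) + (fr x * Im m + fi x * Re m))%R).
    auto_derive; [repeat split; eexists; eassumption|].
    rewrite (is_derive_unique (fun t : R => fr t) x _ H1),
      (is_derive_unique (fun t : R => fi t) x _ H2),
      (is_derive_unique (fun t : R => gr t) x _ H3),
      (is_derive_unique (fun t : R => gi t) x _ H4); ring.
Qed.

Lemma is_derive_RC_inv (f : R -> C) (x : R) (l : C) :
  f x <> RtoC 0 -> is_derive_RC f x l ->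
  is_derive_RC (fun t => / f t) x (- l / (f x * f x)).
Proof.
  intros Hf.
  assert (N : (Re (f x) ^ 2 + Im (f x) ^ 2 <> 0)%R).
  { intros E; apply Hf; destruct (f x) as [a b]; simpl in E.
    unfold RtoC; f_equal; nra. }
  rewrite !is_derive_RC_pair; intros [H1 H2].
  set (fr := fun t => Re (f t)) in *; set (fi := fun t => Im (f t)) in *.
  change (fr x ^ 2 + fi x ^ 2 <> 0)%R in N.
  (* Written with inverses of an explicit pair, the quotient reduces to real components that [field]
     can handle. *)
  assert (D : forall n : C, n / (f x * f x)
    = n * (/ (fr x, fi x) * / (fr x, fi x))).
  { intros n; unfold fr, fi, Re, Im; rewrite <- surjective_pairing; field; exact Hf. }
  rewrite D; split.
  - change (is_derive (fun t => fr t / (fr t ^ 2 + fi t ^ 2))%R x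
      (Re (- l * (/ (fr x, fi x) * / (fr x, fi x))))).
    auto_derive; [repeat split; try (eexists; eassumption); auto|].
    rewrite (is_derive_unique (fun t : R => fr t) x _ H1),
      (is_derive_unique (fun t : R => fi t) x _ H2).
    simpl; unfold Re, Im; field; nra.
  - change (is_derive (fun t => - fi t / (fr t ^ 2 + fi t ^ 2))%R x
      (Im (- l * (/ (fr x, fi x) * / (fr x, fi x))))).
    auto_derive; [repeat split; try (eexists; eassumption); auto|].
    rewrite (is_derive_unique (fun t : R => fr t) x _ H1),
      (is_derive_unique (fun t : R => fi t) x _ H2).
    simpl; unfold Re, Im; field; nra.
Qed.

Lemma is_derive_RC_Cexp (f : R -> C) (x : R) (l : C) :
  is_derive_RC f x l -> is_derive_RC (fun t => Cexp (f t)) x (l * Cexp (f x)).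
Proof.
  rewrite !is_derive_RC_pair; intros [H1 H2].
  set (fr := fun t => Re (f t)) in *; set (fi := fun t => Im (f t)) in *.
  split.
  - change (is_derive (fun t => exp (fr t) * cos (fi t))%R x
      (Re l * (exp (fr x) * cos (fi x)) - Im l * (exp (fr x) * sin (fi x)))%R).
    auto_derive; [repeat split; eexists; eassumption|].
    rewrite (is_derive_unique (fun t : R => fr t) x _ H1),
      (is_derive_unique (fun t : R => fi t) x _ H2); ring.
  - change (is_derive (fun t => exp (fr t) * sin (fi t))%R x
      (Re l * (exp (fr x) * sin (fi x)) + Im l * (exp (fr x) * cos (fi x)))%R).
    auto_derive; [repeat split; eexists; eassumption|].
    rewrite (is_derive_unique (fun t : R => fr t) x _ H1),
      (is_derive_unique (fun t : R => fi t) x _ H2); ring.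
Qed.

(** Inverses and exponentials of non-constant functions are not decomposed: their derivatives must
    stand in the context. Quotients to be differentiated are therefore written as [a * / b]. *)
Ltac derive_rules :=
  lazymatch goal with
  | H : is_derive_RC ?f ?x _ |- is_derive_RC ?f ?x _ => exact H
  | |- is_derive_RC (fun _ => ?a) _ _ => apply is_derive_RC_const
  | |- is_derive_RC RtoC _ _ => apply is_derive_RC_id
  | |- is_derive_RC (fun t => _ + _) _ _ => apply is_derive_RC_plus; derive_rules
  | |- is_derive_RC (fun t => _ - _) _ _ => apply is_derive_RC_minus; derive_rules
  | |- is_derive_RC (fun t => - _) _ _ => apply is_derive_RC_opp; derive_rules
  | |- is_derive_RC (fun t => _ * _) _ _ => apply is_derive_RC_mult; derive_rules
  end.

(** The derivative is first computed as an unknown; what remains is its algebraic equality with the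
    stated one. *)
Ltac derive_RC :=
  eapply is_derive_RC_ext; [reflexivity | | solve [derive_rules]]; cbv beta.

Lemma is_derive_RC_Cexp_affine (w c : C) (x : R) :
  is_derive_RC (fun t => Cexp (w * (RtoC t + c))) x (w * Cexp (w * (RtoC x + c))).
Proof.
  apply (is_derive_RC_Cexp (fun t => w * (RtoC t + c))).
  derive_RC; ring.
Qed.

Lemma is_derive_RC_Cexp_affine_opp (w c : C) (x : R) :
  is_derive_RC (fun t => Cexp (- (w * (RtoC t + c)))) x
    (- w * Cexp (- (w * (RtoC x + c)))).
Proof.
  generalize (is_derive_RC_Cexp_affine (- w) c x).
  apply is_derive_RC_ext; [intros t|]; repeat f_equal; ring.
Qed.

(** * Antiderivatives and constancy on an open interval *)

Lemma in_oo_between (lo hi : Rbar) (a b z : R) :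
  in_oo lo hi a -> in_oo lo hi b -> (Rmin a b <= z <= Rmax a b)%R -> in_oo lo hi z.
Proof.
  intros [Ha1 Ha2] [Hb1 Hb2] [Hz1 Hz2]; split.
  - apply Rbar_lt_le_trans with (Rmin a b); [|exact Hz1].
    unfold Rmin; destruct Rle_dec; assumption.
  - apply Rbar_le_lt_trans with (Rmax a b); [exact Hz2|].
    unfold Rmax; destruct Rle_dec; assumption.
Qed.

(** A differentiable function is continuous, so its integral from a base point is an antiderivative.
    On an empty interval any function serves. *)
Lemma antiderivative_exists (lo hi : Rbar) (u : R -> C) :
  (forall x, in_oo lo hi x -> exists l, is_derive_RC u x l) ->
  exists U : R -> C, is_antiderivative lo hi u U.
Proof.
  intros Hu.
  assert (Cu : forall x, in_oo lo hi x -> continuous (U := C_R_NormedModule) u x).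
  { intros x Hx; apply ex_derive_continuous, (Hu x Hx). }
  destruct (classic (exists x0, in_oo lo hi x0)) as [[x0 H0]|H0].
  - exists (RInt (V := C_R_CompleteNormedModule) u x0); intros x Hx.
    apply (is_derive_RInt (V := C_R_NormedModule) u _ x0); [|apply Cu, Hx].
    apply (locally_interval _ x lo hi); [apply Hx|apply Hx|].
    intros y Hy1 Hy2.
    apply (RInt_correct (V := C_R_CompleteNormedModule)).
    apply (ex_RInt_continuous (V := C_R_CompleteNormedModule)).
    intros z Hz; apply Cu, (in_oo_between lo hi x0 y); auto; split; assumption.
  - exists u; intros x Hx; destruct H0; exists x; exact Hx.
Qed.

(** Any two points of the interval are joined by a segment inside it, on which the vanishing
    derivative forces equal values; the constant is the value at a base point. *)
Lemma is_derive_RC_zero_constant (lo hi : Rbar) (f : R -> C) :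
  (forall x, in_oo lo hi x -> is_derive_RC f x (RtoC 0)) ->
  exists K : C, forall x, in_oo lo hi x -> f x = K.
Proof.
  intros Hf.
  assert (L : forall a b, in_oo lo hi a -> in_oo lo hi b -> (a < b)%R -> f a = f b).
  { intros a b Ha Hb Hab.
    apply (eq_is_derive (V := C_R_NormedModule)); [|exact Hab].
    intros t Ht; apply Hf, (in_oo_between lo hi a b); auto.
    rewrite Rmin_left, Rmax_right; lra. }
  destruct (classic (exists x0, in_oo lo hi x0)) as [[x0 H0]|H0].
  - exists (f x0); intros x Hx.
    destruct (Rtotal_order x x0) as [H|[->|H]]; auto.
    symmetry; auto.
  - exists (RtoC 0); intros x Hx; destruct H0; exists x; exact Hx.
Qed.

Lemma is_derive_RC_eq_on (lo hi : Rbar) (f g : R -> C) (x : R) (l : C) :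
  in_oo lo hi x -> (forall t, in_oo lo hi t -> f t = g t) ->
  is_derive_RC f x l -> is_derive_RC g x l.
Proof.
  intros Hx E; apply is_derive_ext_loc.
  apply (locally_interval _ x lo hi); [apply Hx|apply Hx|].
  intros y Hy1 Hy2; apply E; split; assumption.
Qed.

(** * Removal of the first-order term *)

Lemma ode_liouville (lo hi : Rbar) (B B' Cf Rf A y : R -> C) (k : C) :
  (forall x, in_oo lo hi x -> is_derive_RC B x (B' x)) ->
  (forall x, in_oo lo hi x ->
    (B x * B x + RtoC 2 * B' x - RtoC 4 * Cf x) / RtoC 4 = k) ->
  is_antiderivative lo hi (fun x => B x / RtoC 2) A ->
  solves_ode2 lo hi B Cf Rf y <->
  solves_ode2 lo hi (fun _ => RtoC 0) (fun _ => - k)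
    (fun x => Cexp (A x) * Rf x) (fun x => Cexp (A x) * y x).
Proof.
  intros hB hk hA.
  assert (n2 : RtoC 2 <> RtoC 0) by (intros E; apply RtoC_inj in E; lra).
  assert (n4 : RtoC 4 <> RtoC 0) by (intros E; apply RtoC_inj in E; lra).
  assert (hC : forall x, in_oo lo hi x ->
    Cf x = B x * B x / RtoC 4 + B' x / RtoC 2 - k).
  { intros x Hx; rewrite <- (hk x Hx); field; auto. }
  assert (dE : forall x, in_oo lo hi x ->
    is_derive_RC (fun t => Cexp (A t)) x (B x / RtoC 2 * Cexp (A x))).
  { intros x Hx; apply is_derive_RC_Cexp, hA, Hx. }
  assert (dE' : forall x, in_oo lo hi x ->
    is_derive_RC (fun t => Cexp (- A t)) x (- (B x / RtoC 2) * Cexp (- A x))).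
  { intros x Hx; apply (is_derive_RC_Cexp (fun t => - A t)).
    apply is_derive_RC_opp, hA, Hx. }
  split; intros (y' & y'' & H).
  (* These are z' and z'' for z = e^A y; by [hC], z'' - k z = e^A (y'' + B y' + C y). *)
  - exists (fun x => Cexp (A x) * (y' x + B x * / RtoC 2 * y x)).
    exists (fun x => Cexp (A x) * (y'' x + B x * y' x
      + (B x * B x / RtoC 4 + B' x / RtoC 2) * y x)).
    intros x Hx; destruct (H x Hx) as (H1 & H2 & H3).
    specialize (hB x Hx); specialize (dE x Hx); specialize (hC x Hx).
    split; [|split].
    + derive_RC; field; auto.
    + derive_RC; field; auto.
    + rewrite <- H3, hC; ring.
  (* Here [y'] and [y''] belong to z = e^A y, and the witnesses are the derivatives of e^(-A) z,
     hence the opposite sign of B. *)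
  - exists (fun x => Cexp (- A x) * (y' x - B x * / RtoC 2 * (Cexp (A x) * y x))).
    exists (fun x => Cexp (- A x) * (y'' x - B x * y' x
      + (B x * B x / RtoC 4 - B' x / RtoC 2) * (Cexp (A x) * y x))).
    intros x Hx; destruct (H x Hx) as (H1 & H2 & H3).
    specialize (hB x Hx); specialize (dE' x Hx); specialize (hC x Hx).
    assert (U := Cexp_mul_opp (A x)).
    split; [|split].
    (* Only z is known to be differentiable, so y is first rewritten as e^(-A) z. *)
    + apply (is_derive_RC_ext (fun t => Cexp (- A t) * (Cexp (A t) * y t)) _ x
        (- (B x / RtoC 2) * Cexp (- A x) * (Cexp (A x) * y x) + Cexp (- A x) * y' x)).
      * intros t; rewrite Cmult_assoc, (Cmult_comm (Cexp (- A t))), Cexp_mul_opp; ring.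
      * field; auto.
      * apply is_derive_RC_mult; assumption.
    + derive_RC; field; auto.
    + transitivity (Cexp (A x) * Cexp (- A x) * Rf x); [|rewrite U; ring].
      transitivity (Cexp (- A x) * (Cexp (A x) * Rf x)); [|ring].
      rewrite <- H3, hC.
      (* Expressing everything through z and e^(-A) leaves z as an atom for [field]. *)
      assert (Y : y x = Cexp (- A x) * (Cexp (A x) * y x))
        by (rewrite Cmult_assoc, (Cmult_comm (Cexp (- A x))), U; ring).
      remember (Cexp (A x) * y x) as zx; rewrite Y; field; auto.
Qed.

(** * The equation with constant coefficients *)

Lemma is_derive_RC_s_fun (w c : C) (x : R) :
  is_derive_RC (s_fun w c) x
    (w * (Cexp (w * (RtoC x + c)) + Cexp (- (w * (RtoC x + c))))).
Proof.
  generalize (is_derive_RC_Cexp_affine w c x) (is_derive_RC_Cexp_affine_opp w c x).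
  intros H1 H2.
  change (s_fun w c)
    with (fun t : R => Cexp (w * (RtoC t + c)) - Cexp (- (w * (RtoC t + c)))).
  derive_RC; ring.
Qed.

(** Forward, two successive first integrals determine z; backward, s Q is a particular solution, and
    the two exponentials solve the homogeneous equation. *)
Lemma ode_constant_coefficients (lo hi : Rbar) (w c : C) (G P Q z : R -> C) :
  w <> RtoC 0 ->
  (forall x, in_oo lo hi x -> s_fun w c x <> RtoC 0) ->
  is_antiderivative lo hi (fun x => G x * s_fun w c x) P ->
  is_antiderivative lo hi
    (fun x => RtoC 1 / (s_fun w c x * s_fun w c x) * P x) Q ->
  solves_ode2 lo hi (fun _ => RtoC 0) (fun _ => - (w * w)) G z <->
  exists C1 C2 : C, forall x, in_oo lo hi x ->
    z x = s_fun w c x * Q x + C1 * Cexp (- (w * (RtoC x + c)))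
          + C2 * Cexp (w * (RtoC x + c)).
Proof.
  intros hw hs hP hQ.
  assert (n2 : RtoC 2 <> RtoC 0) by (intros E; apply RtoC_inj in E; lra).
  set (e := fun t : R => Cexp (w * (RtoC t + c))).
  set (f := fun t : R => Cexp (- (w * (RtoC t + c)))).
  assert (de : forall x, is_derive_RC e x (w * e x))
    by (intros x; apply is_derive_RC_Cexp_affine).
  assert (df : forall x, is_derive_RC f x (- w * f x))
    by (intros x; apply is_derive_RC_Cexp_affine_opp).
  assert (ds : forall x, is_derive_RC (s_fun w c) x (w * (e x + f x)))
    by (intros x; apply is_derive_RC_s_fun).
  assert (hs_ef : forall x, s_fun w c x = e x - f x) by reflexivity.
  assert (ef : forall x, e x * f x = RtoC 1) by (intros x; apply Cexp_mul_opp).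
  unfold is_antiderivative in hP, hQ.
  change (solves_ode2 lo hi (fun _ => RtoC 0) (fun _ => - (w * w)) G z <->
    exists C1 C2 : C, forall x, in_oo lo hi x ->
      z x = s_fun w c x * Q x + C1 * f x + C2 * e x).
  (* From here on e, f and s are atoms, tied together only by s = e - f, e f = 1 and their
     derivatives. *)
  clearbody e f.
  set (s := s_fun w c) in *; clearbody s.
  split.
  - intros (z' & z'' & H).
    (* First integral: (z' s - z s')' = (z'' - w^2 z) s = G s = P'. *)
    destruct (is_derive_RC_zero_constant lo hi
      (fun x => z' x * s x - z x * (w * (e x + f x)) - P x)) as [K HK].
    { intros x Hx; destruct (H x Hx) as (H1 & H2 & H3).
      specialize (hP x Hx); specialize (de x); specialize (df x); specialize (ds x).
      simpl in H3, hP; rewrite <- H3 in hP.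
      derive_RC; rewrite !hs_ef; ring. }
    (* Second integral: (z/s)' = (P + K)/s^2, and (f/s)' = - 2 w e f / s^2 = - 2 w / s^2, so the
       last term cancels K/s^2. *)
    destruct (is_derive_RC_zero_constant lo hi
      (fun x => z x * / s x - Q x + K / (RtoC 2 * w) * (f x * / s x))) as [D HD].
    { intros x Hx; destruct (H x Hx) as (H1 & H2 & _).
      specialize (HK x Hx); specialize (hQ x Hx); specialize (hs x Hx).
      specialize (de x); specialize (df x).
      assert (di := is_derive_RC_inv s x _ hs (ds x)).
      simpl in HK, hQ.
      assert (HP : P x = z' x * s x - z x * (w * (e x + f x)) - K)
        by (rewrite <- HK; ring).
      rewrite HP in hQ; derive_RC.
      transitivity (K * (RtoC 1 - e x * f x) / (s x * s x)); [|rewrite ef; field; auto].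
      rewrite (hs_ef x) in *; field; auto. }
    (* The second integral reads z = s Q + D s - K/(2w) f; the coefficients appear on expanding s =
       e - f. *)
    exists (- D - K / (RtoC 2 * w)), D; intros x Hx.
    specialize (HD x Hx); specialize (hs x Hx); simpl in HD.
    replace (e x) with (s x + f x) by (rewrite hs_ef; ring).
    rewrite <- HD; field; auto.
  - intros (C1 & C2 & H).
    (* Since Q' = P/s^2, (s Q)' = s' Q + P/s. In the next derivative the two terms s' P/s^2 cancel,
       leaving w^2 s Q + G. *)
    exists (fun x => w * (e x + f x) * Q x + / s x * P x - C1 * w * f x + C2 * w * e x).
    exists (fun x => w * w * (s x * Q x + C1 * f x + C2 * e x) + G x).
    intros x Hx.
    assert (Hs := hs x Hx).
    assert (di := is_derive_RC_inv s x _ Hs (ds x)).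
    specialize (hP x Hx); specialize (hQ x Hx).
    specialize (de x); specialize (df x); specialize (ds x).
    split; [|split].
    (* The formula for z holds only inside the interval, which suffices because the interval is
       open. *)
    + apply (is_derive_RC_eq_on lo hi (fun t => s t * Q t + C1 * f t + C2 * e t));
        [exact Hx|intros t Ht; symmetry; apply H, Ht|].
      simpl in hQ; derive_RC; field; auto.
    + simpl in hP, hQ; derive_RC; rewrite (hs_ef x) in *; field; auto.
    + rewrite (H x Hx); ring.
Qed.

(* The coefficients B, C, R are B, Cf, Rf; B' is the derivative of B; sqrtk is
   a chosen square root of k.  A, P, Q are arbitrary antiderivatives. *)
Theorem corollary2
  (lo hi : Rbar) (B B' Cf Rf : R -> C) (k sqrtk c : C)
  (hB : forall x : R, in_oo lo hi x -> is_derive_RC B x (B' x))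
  (hk0 : k <> RtoC 0)
  (hk : forall x : R, in_oo lo hi x ->
    (B x * B x + RtoC 2 * B' x - RtoC 4 * Cf x) / RtoC 4 = k)
  (hsqrt : sqrtk * sqrtk = k)
  (hs : forall x : R, in_oo lo hi x -> s_fun sqrtk c x <> RtoC 0) :
  (exists A : R -> C, is_antiderivative lo hi (fun x => B x / RtoC 2) A) /\
  forall A : R -> C, is_antiderivative lo hi (fun x => B x / RtoC 2) A ->
  forall P : R -> C,
    is_antiderivative lo hi (fun x => Cexp (A x) * s_fun sqrtk c x * Rf x) P ->
  (exists Q : R -> C, is_antiderivative lo hi
     (fun x => RtoC 1 / (s_fun sqrtk c x * s_fun sqrtk c x) * P x) Q) /\
  forall Q : R -> C,
    is_antiderivative lo hi
      (fun x => RtoC 1 / (s_fun sqrtk c x * s_fun sqrtk c x) * P x) Q ->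
  forall y : R -> C,
    solves_ode2 lo hi B Cf Rf y <->
    exists C1 C2 : C, forall x : R, in_oo lo hi x ->
      y x = Cexp (- A x) * s_fun sqrtk c x * Q x
            + C1 * Cexp (- (A x + sqrtk * (RtoC x + c)))
            + C2 * Cexp (- A x + sqrtk * (RtoC x + c)).
Proof.
  assert (hw : sqrtk <> RtoC 0) by (intros E; apply hk0; rewrite <- hsqrt, E; ring).
  split.
  { apply antiderivative_exists; intros x Hx; exists (B' x / RtoC 2).
    specialize (hB x Hx); unfold Cdiv; derive_RC; ring. }
  intros A hA P hP; split.
  (* The integrand is differentiable: P is an antiderivative, and s is differentiable without zeros
     on the interval. *)
  { apply antiderivative_exists; intros x Hx; eexists; unfold Cdiv.
    apply is_derive_RC_mult; [|exact (hP x Hx)].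
    apply is_derive_RC_mult; [apply is_derive_RC_const|].
    apply (is_derive_RC_inv (fun t => s_fun sqrtk c t * s_fun sqrtk c t)).
    - apply Cmult_neq_0; exact (hs x Hx).
    - apply is_derive_RC_mult; apply is_derive_RC_s_fun. }
  intros Q hQ y.
  rewrite (ode_liouville lo hi B B' Cf Rf A y k hB hk hA).
  rewrite <- hsqrt.
  assert (hP' : is_antiderivative lo hi
    (fun x => Cexp (A x) * Rf x * s_fun sqrtk c x) P).
  { intros x Hx; generalize (hP x Hx).
    apply is_derive_RC_ext; [reflexivity|ring]. }
  rewrite (ode_constant_coefficients lo hi sqrtk c _ P Q _ hw hs hP' hQ).
  assert (E1 : forall x, Cexp (- (A x + sqrtk * (RtoC x + c)))
    = Cexp (- A x) * Cexp (- (sqrtk * (RtoC x + c))))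
    by (intros x; rewrite <- Cexp_add; f_equal; ring).
  (* The formulas for e^A y and for y differ by the invertible factor e^A, so the same constants
     serve in both directions. *)
  split; intros (C1 & C2 & H); exists C1, C2; intros x Hx; specialize (H x Hx).
  - rewrite E1, Cexp_add.
    transitivity (Cexp (- A x) * (Cexp (A x) * y x)); [|rewrite H; ring].
    rewrite Cmult_assoc, (Cmult_comm (Cexp (- A x))), Cexp_mul_opp; ring.
  - rewrite H, E1, Cexp_add.
    set (v := s_fun _ _ _ * Q x + _ + _).
    transitivity (Cexp (A x) * Cexp (- A x) * v); [unfold v; ring|].
    rewrite Cexp_mul_opp; ring.
Qed.
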